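(* Let $T$ be a standard Young tableau of a strip shape with $n$ cells, and let $\phi T:=\widetilde{\mathrm{jdt}}(1+T)=p^{-1}T$, where $p$ is the promotion operator. Then $$\mathrm{cDes}(\phi T)=1+\mathrm{cDes}(T),$$ with addition modulo $n$.
   Context: Let $[n]=\{1,\dots,n\}$. Tableaux are in English notation (row 1 on top). $\mathrm{Des}(T)=\{i\in[n-1]:i+1\text{ is in a lower row than }i\text{ in }T\}$. For $D\subseteq[n]$, $1+D\subseteq[n]$ is obtained by adding $1$ modulo $n$ to each element of $D$. A strip is a skew shape all of whose connected components have either only one row or only one column; a vertical component is a component consisting of a single column (with at least two cells). For a standard Young tableau $T$ of strip shape with $n$ cells, $\mathrm{cDes}(T)\subseteq[n]$ is defined by $\mathrm{cDes}(T)\cap[n-1]=\mathrm{Des}(T)$ and: $n\in\mathrm{cDes}(T)$ if and only if either $n$ is in a row strictly above the row of $1$, or $1$ and $n$ are in the same vertical component. For an integer $a$, $a+T$ is the filling obtained by adding $a$ modulo $n$ (with values in $[n]$) to each entry of $T$, and $\widetilde{\mathrm{jdt}}(a+T)$ is the standard tableau obtained from $T_0=a+T$ by repeating the following step until $T_0$ is standard: let $i$ be the minimal entry of $T_0$ such that the entries immediately above it and immediately to its left (those that exist) are not all smaller than $i$; switch $i$ with the larger of these entries. (For a strip, this simply sorts the entries within each component.) Promotion is $pT=\widetilde{\mathrm{jdt}}(-1+T)$. *)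

(* Defs.v *)
From mathcomp Require Import all_boot all_order all_fingroup all_algebra.

Set Implicit Arguments.
Unset Strict Implicit.
Unset Printing Implicit Defensive.

Definition is_partition (l : seq nat) : bool := sorted geq l && (0 \notin l).

Definition is_skew_shape (lam mu : seq nat) : Prop :=
  [/\ is_partition lam, is_partition mu
    & forall r, nth 0 mu r <= nth 0 lam r].

(* Row 0 is the top row and column 0 is the leftmost column. *)
Definition cell (lam mu : seq nat) : Type :=
  {rc : 'I_(size lam) * 'I_(head 0 lam)
    | nth 0 mu rc.1 <= rc.2 < nth 0 lam rc.1}.

Definition crow lam mu (c : cell lam mu) : nat := (val c).1.
Definition ccol lam mu (c : cell lam mu) : nat := (val c).2.

Definition ncells (lam mu : seq nat) : nat := #|{: cell lam mu}|.

Definition above lam mu (d c : cell lam mu) : bool :=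
  ((crow d).+1 == crow c) && (ccol d == ccol c).
Definition left_of lam mu (d c : cell lam mu) : bool :=
  (crow d == crow c) && ((ccol d).+1 == ccol c).

Definition adjacent lam mu : rel (cell lam mu) := fun c d =>
  [|| above c d, above d c, left_of c d | left_of d c].

Definition component lam mu (c : cell lam mu) : {set cell lam mu} :=
  [set d | connect (@adjacent lam mu) c d].

Definition one_row lam mu (A : {set cell lam mu}) : bool :=
  [forall c in A, forall d in A, crow c == crow d].
Definition one_column lam mu (A : {set cell lam mu}) : bool :=
  [forall c in A, forall d in A, ccol c == ccol d].

Definition is_strip (lam mu : seq nat) : Prop :=
  is_skew_shape lam mu /\
  forall c : cell lam mu, one_row (component c) || one_column (component c).

Definition is_vertical lam mu (A : {set cell lam mu}) : bool :=
  one_column A && (1 < #|A|).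

Definition filling (lam mu : seq nat) : Type := {ffun cell lam mu -> nat}.

Definition is_standard lam mu (T : filling lam mu) : Prop :=
  [/\ injective T,
      forall c, 1 <= T c <= ncells lam mu,
      forall c d, crow c = crow d -> ccol c < ccol d -> T c < T d
    & forall c d, ccol c = ccol d -> crow c < crow d -> T c < T d].

Definition Des lam mu (T : filling lam mu) : seq nat :=
  [seq i <- iota 1 (ncells lam mu).-1
    | [exists c, exists d, [&& T c == i, T d == i.+1 & crow c < crow d]]].

Definition cDes lam mu (T : filling lam mu) : seq nat :=
  let n := ncells lam mu in
  [seq i <- iota 1 n
    | if i == n then
        [exists c, exists d, [&& T c == n, T d == 1
          & (crow c < crow d)
            || (d \in component c) && is_vertical (component c)]]
      else i \in Des T].

(* Addition modulo n with representatives 1, ..., n instead of 0, ..., n - 1. *)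
Definition add_mod (n : nat) (a : int) (x : nat) : nat :=
  (absz ((x%:Z - 1 + a) %% n%:Z)%Z).+1.

Definition shift_set (n : nat) (a : int) (D : seq nat) : seq nat :=
  [seq add_mod n a x | x <- D].

Definition shift_filling lam mu (a : int) (T : filling lam mu) :
    filling lam mu :=
  [ffun c => add_mod (ncells lam mu) a (T c)].

Definition misplaced lam mu (T : filling lam mu) (c : cell lam mu) : bool :=
  [exists d, (above d c || left_of d c) && ~~ (T d < T c)].

Definition jdt_step lam mu (T : filling lam mu) : filling lam mu :=
  if [pick c | misplaced T c &
        [forall c', misplaced T c' ==> (T c <= T c')]] is Some c then
    if [pick d | above d c || left_of d c &
          [forall d', (above d' c || left_of d' c) ==> (T d' <= T d)]]
      is Some d then [ffun x => T (tperm c d x)] else T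
  else T.

(* jdt_step permutes entries and fixes every standard filling. There are n ^ n
   fillings with entries in [n], so if iterating jdt_step from T ever reaches
   a standard filling, it has done so after n ^ n steps. *)
Definition jdt lam mu (T : filling lam mu) : filling lam mu :=
  iter (ncells lam mu ^ ncells lam mu) (@jdt_step lam mu) T.

Definition promotion lam mu (T : filling lam mu) : filling lam mu :=
  jdt (shift_filling (-1)%R T).

Definition phi lam mu (T : filling lam mu) : filling lam mu :=
  jdt (shift_filling 1%R T).

(* Main.v *)
Require Import Defs.
From mathcomp Require Import all_boot all_order all_fingroup all_algebra.
From mathcomp Require Import zify.

(** On any skew shape, each jeu de taquin step exchanges two adjacent cells,
    so [jdt] permutes the entries within each connected component
    ([jdt_permutes]).  If the entries are distinct, it ends at a filling
    without misplaced cells ([jdt_sorts]), which on a skew shape means a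
    standard one.

    On a strip, a component is totally ordered by row + column, and a standard
    filling increases along it; so a standard filling is determined by which
    entries lie in which component ([standard_component_unique]).  Hence
    shifting by a, sorting, shifting by -a and sorting again gives back T, and
    promotion and phi are mutually inverse.

    Whether i is a cyclic descent of T also depends only on the components of
    the cells c and d that contain i and i + 1 modulo n ([cDesP]): within one
    component the question is whether it is vertical, and two different
    components are strictly ordered by height, since cells of one row are
    connected ([cyclic_descent_cells_connect]).  As [phi] adds 1 to the content
    of each component, it adds 1 to each cyclic descent.  The exceptional rule
    for n in the definition of [cDes] is exactly what makes this description
    uniform in i. *)

Set Implicit Arguments.
Unset Strict Implicit.
Unset Printing Implicit Defensive.

(** * Addition modulo n on 1, ..., n *)

Lemma add_mod_bounds n a x : 0 < n -> 1 <= add_mod n a x <= n.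
Proof.
rewrite /add_mod => n_gt0; have n_neq0 : (n%:Z != 0)%R by lia.
by have := modz_ge0 (x%:Z - 1 + a)%R n_neq0;
   have := @ltz_pmod (x%:Z - 1 + a)%R (n%:Z)%R; lia.
Qed.

Lemma add_modD n a b x :
  0 < n -> add_mod n b (add_mod n a x) = add_mod n (a + b)%R x.
Proof.
move=> n_gt0; rewrite /add_mod; congr (_.+1); congr absz.
have n_neq0 : (n%:Z != 0)%R by lia.
have m_ge0 := modz_ge0 (x%:Z - 1 + a)%R n_neq0.
have -> : ((absz ((x%:Z - 1 + a) %% n%:Z)%Z).+1%:Z - 1 + b
           = ((x%:Z - 1 + a) %% n%:Z)%Z + b)%R by lia.
by rewrite modzDml; congr (modz _ _); lia.
Qed.

Lemma add_mod0 n x : 1 <= x <= n -> add_mod n 0 x = x.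
Proof.
move=> x_bd; rewrite /add_mod GRing.addr0 modz_small; lia.
Qed.

Lemma add_modK n a b x :
  (a + b = 0)%R -> 1 <= x <= n -> add_mod n b (add_mod n a x) = x.
Proof.
by move=> ab0 x_bd; rewrite add_modD ?ab0 ?add_mod0 //; lia.
Qed.

Lemma add_mod_inj n a x y :
  1 <= x <= n -> 1 <= y <= n -> add_mod n a x = add_mod n a y -> x = y.
Proof.
move=> x_bd y_bd /(congr1 (add_mod n (- a)%R)).
by rewrite !add_modK ?GRing.subrr.
Qed.

Lemma add_mod1 n x : 1 <= x <= n ->
  add_mod n 1%R x = if x == n then 1 else x.+1.
Proof.
move=> x_bd; rewrite /add_mod.
have -> : (x%:Z - 1 + 1 = x%:Z)%R by lia.
case: eqP => [->|xn]; first by rewrite modzz.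
by rewrite modz_small; lia.
Qed.

(** * Cells of a skew shape *)

Lemma partition_nth_mono l r r' :
  is_partition l -> r <= r' -> nth 0 l r' <= nth 0 l r.
Proof.
case/andP=> l_sorted _ le_rr'.
case: (ltnP r' (size l)) => [lt_r'|ge_r']; last by rewrite nth_default.
have geq_trans : transitive geq by move=> ? ? ? /= ? ?; lia.
apply: (sorted_leq_nth geq_trans leqnn 0 l_sorted) => //=.
by rewrite inE; lia.
Qed.

Lemma cell_at lam mu r j : is_partition lam ->
  nth 0 mu r <= j < nth 0 lam r ->
  exists c : cell lam mu, crow c = r /\ ccol c = j.
Proof.
move=> lamP j_bd.
have r_lt : r < size lam.
  case: (ltnP r (size lam)) => // ge_r.
  by move: j_bd; rewrite (nth_default 0 ge_r); lia.
have j_lt : j < head 0 lam.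
  by have := partition_nth_mono lamP (leq0n r); rewrite nth0; lia.
by exists (exist _ (Ordinal r_lt, Ordinal j_lt) j_bd).
Qed.

Lemma cell_bounds lam mu (c : cell lam mu) :
  nth 0 mu (crow c) <= ccol c < nth 0 lam (crow c).
Proof. exact: (valP c). Qed.

Lemma cell_eq lam mu (c d : cell lam mu) :
  crow c = crow d -> ccol c = ccol d -> c = d.
Proof.
case: c d => [[r j] p] [[r' j'] p'] /= eq_r eq_j; apply: val_inj => /=.
by congr (_, _); apply: val_inj.
Qed.

(** The rows and columns of a skew shape have no gaps, so a transitive relation
    propagates from neighbours to all pairs of cells of a row, or of a column.
    It is used both for connectedness and for the order of the entries. *)
Lemma same_row_rel lam mu (R : cell lam mu -> cell lam mu -> Prop) :
  is_skew_shape lam mu -> (forall x y z, R x y -> R y z -> R x z) ->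
  (forall x y, left_of x y -> R x y) ->
  forall c d, crow c = crow d -> ccol c < ccol d -> R c d.
Proof.
move=> [lamP _ _] R_trans R_left c d.
have [m] := ubnP (ccol d - ccol c); elim: m c => // m IHm c lt_m eq_row lt_col.
have [||e [row_e col_e]] := @cell_at lam mu (crow c) (ccol c).+1 => //.
  by have := cell_bounds c; have := cell_bounds d; rewrite -eq_row; lia.
have R_ce : R c e by apply: R_left; rewrite /left_of row_e col_e !eqxx.
have [col_de|ne_de] := eqVneq (ccol e) (ccol d).
  by rewrite (@cell_eq _ _ d e) ?row_e.
by apply: R_trans R_ce _; apply: IHm; lia.
Qed.

Lemma same_column_rel lam mu (R : cell lam mu -> cell lam mu -> Prop) :
  is_skew_shape lam mu -> (forall x y z, R x y -> R y z -> R x z) ->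
  (forall x y, above x y -> R x y) ->
  forall c d, ccol c = ccol d -> crow c < crow d -> R c d.
Proof.
move=> [lamP muP _] R_trans R_above c d.
have [m] := ubnP (crow d - crow c); elim: m c => // m IHm c lt_m eq_col lt_row.
have [||e [row_e col_e]] := @cell_at lam mu (crow c).+1 (ccol c) => //.
  have := partition_nth_mono muP (leqnSn (crow c)).
  have := partition_nth_mono lamP lt_row.
  by have := cell_bounds c; have := cell_bounds d; rewrite -eq_col; lia.
have R_ce : R c e by apply: R_above; rewrite /above row_e col_e !eqxx.
have [row_de|ne_de] := eqVneq (crow e) (crow d).
  by rewrite (@cell_eq _ _ d e) ?col_e.
by apply: R_trans R_ce _; apply: IHm; lia.
Qed.

Lemma adjacent_sym lam mu : symmetric (@adjacent lam mu).
Proof.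
by move=> c d; rewrite /adjacent; apply/idP/idP; case/or4P => ->; rewrite ?orbT.
Qed.

Lemma adjacent_connect_sym lam mu : connect_sym (@adjacent lam mu).
Proof. exact/sym_connect_sym/adjacent_sym. Qed.

Lemma same_row_connect lam mu (c d : cell lam mu) :
  is_skew_shape lam mu -> crow c = crow d -> connect (@adjacent lam mu) c d.
Proof.
move=> shape eq_row.
have lt_connect := same_row_rel
  (R := fun x y => connect (@adjacent lam mu) x y) shape.
have {}lt_connect x y : crow x = crow y -> ccol x < ccol y ->
    connect (@adjacent lam mu) x y.
  apply: lt_connect => [? ? ?|? ? xy]; first exact: connect_trans.
  by apply: connect1; rewrite /adjacent xy !orbT.
case: (ltngtP (ccol c) (ccol d)) => [||eq_col]; first exact: lt_connect.
  by rewrite adjacent_connect_sym; apply: lt_connect.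
by rewrite (cell_eq eq_row eq_col) connect0.
Qed.

(** * Sorting by jeu de taquin *)

Definition permute_filling lam mu (T : filling lam mu)
    (s : {perm cell lam mu}) : filling lam mu := [ffun x => T (s x)].

Definition preserves_components lam mu (s : {perm cell lam mu}) : Prop :=
  forall x, connect (@adjacent lam mu) x (s x).

Lemma permute_fillingM lam mu (T : filling lam mu) s t :
  permute_filling (permute_filling T s) t = permute_filling T (t * s)%g.
Proof. by apply/ffunP=> x; rewrite !ffunE permM. Qed.

Lemma preserves_componentsM lam mu (s t : {perm cell lam mu}) :
  preserves_components s -> preserves_components t ->
  preserves_components (s * t)%g.
Proof.
by move=> sP tP x; rewrite permM; apply: connect_trans (sP x) (tP _).
Qed.

(** A potential for sorting: it grows whenever a larger entry moves away from
    the top left corner in exchange for a smaller one. *)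
Definition weight lam mu (T : filling lam mu) : nat :=
  \sum_c (crow c + ccol c) * T c.

Lemma jdt_stepE lam mu (T : filling lam mu) :
  (forall c, ~~ misplaced T c) /\ jdt_step T = T \/
  exists c d, [/\ above d c || left_of d c, T c <= T d
                & jdt_step T = permute_filling T (tperm c d)].
Proof.
rewrite /jdt_step; case: pickP => [c /andP[c_mis _]|no_min]; last first.
  left; split=> // c; apply/negP => c_mis.
  case: (arg_minnP (fun x => T x) c_mis) => m m_mis m_min.
  have := no_min m; rewrite m_mis /=; move/negP; apply.
  by apply/forallP => x; apply/implyP => /m_min.
right; case/existsP: c_mis => d /andP[dc T_dc].
case: pickP => [e /andP[ec /forallP e_max]|no_max]; last first.
  case: (arg_maxnP (P := fun x => above x c || left_of x c) (fun x => T x) dc)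
    => m mc m_max.
  have := no_max m; rewrite mc /=; move/negP; case.
  by apply/forallP => x; apply/implyP => /m_max.
exists c, e; split=> //.
by have := e_max d; rewrite dc /=; lia.
Qed.

Lemma weight_swap lam mu (T : filling lam mu) c d :
  above d c || left_of d c -> T c < T d ->
  weight T < weight (permute_filling T (tperm c d)).
Proof.
move=> dc lt_T.
have key : crow c + ccol c = (crow d + ccol d).+1.
  by move: dc; rewrite /above /left_of; lia.
have ne_dc : d != c by apply: contraTneq lt_T => ->; rewrite ltnn.
have split_weight U : weight U = (crow c + ccol c) * U c
    + ((crow d + ccol d) * U d
    + \sum_(i | (i != c) && (i != d)) (crow i + ccol i) * U i).
  by rewrite /weight (bigD1 c) //= (bigD1 d).
rewrite !split_weight !ffunE tpermL tpermR key.
rewrite (eq_bigr (fun i => (crow i + ccol i) *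
                           permute_filling T (tperm c d) i)); last first.
  by move=> i /andP[ic id]; rewrite ffunE tpermD // eq_sym.
by set S := bigop _ _ _; rewrite !mulSn; lia.
Qed.

Lemma jdt_permutes lam mu (T : filling lam mu) :
  exists2 s, preserves_components s & jdt T = permute_filling T s.
Proof.
rewrite /jdt; elim: (_ ^ _) => [|m [s sP IHm]] /=.
  exists 1%g => [x|]; first by rewrite perm1.
  by apply/ffunP => x; rewrite ffunE perm1.
rewrite {}IHm; case: (jdt_stepE (permute_filling T s)) => [[_ ->]|].
  by exists s.
move=> [c [d [dc _ ->]]]; exists (tperm c d * s)%g.
  apply: preserves_componentsM => // x; case: tpermP => [->|->|_ _] //.
  - by apply: connect1; rewrite /adjacent; case/orP: dc => ->; rewrite ?orbT.
  - by apply: connect1; rewrite /adjacent; case/orP: dc => ->; rewrite ?orbT.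
by rewrite permute_fillingM.
Qed.

(** Each effective step increases [weight], so the number of rearrangements of
    T heavier than the current filling drops.  That number is at most n!, hence
    at most n ^ n, the number of steps that [jdt] performs. *)
Lemma jdt_sorts lam mu (T : filling lam mu) :
  injective T -> forall c, ~~ misplaced (jdt T) c.
Proof.
move=> T_inj.
pose heavier (U : filling lam mu) :=
  [set s | weight U < weight (permute_filling T s)].
have step s : (forall c, ~~ misplaced (permute_filling T s) c) /\
      jdt_step (permute_filling T s) = permute_filling T s \/
    exists2 t, jdt_step (permute_filling T s) = permute_filling T t
             & weight (permute_filling T s) < weight (permute_filling T t).
  case: (jdt_stepE (permute_filling T s)) => [|[c [d [dc le_T ->]]]].
    by left.
  right; exists (tperm c d * s)%g; rewrite -permute_fillingM //.
  apply: (weight_swap dc).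
  rewrite ltn_neqAle le_T andbT !ffunE; apply/eqP => /T_inj /perm_inj eq_cd.
  by move: dc; rewrite eq_cd /above /left_of; lia.
have sorts N : forall s, #|heavier (permute_filling T s)| <= N ->
    forall c, ~~ misplaced (iter N (@jdt_step lam mu) (permute_filling T s)) c.
  elim: N => [|N IHN] s le_N;
    case: (step s) => [[sorted_s step_s]|[t step_t w_lt]] //; rewrite ?iterSr.
  - move: le_N; rewrite leqn0 cards_eq0 => /eqP/setP/(_ t).
    by rewrite !inE w_lt.
  - by rewrite step_s iter_fix.
  rewrite step_t; apply: IHN; rewrite -ltnS; apply: leq_trans le_N.
  apply/proper_card/properP; split.
    by apply/subsetP => u; rewrite !inE; apply: ltn_trans.
  by exists t; rewrite !inE ?w_lt // ltnn.
have T1 : permute_filling T 1 = T by apply/ffunP=> x; rewrite ffunE perm1.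
rewrite -{1}T1; apply: sorts; apply: leq_trans (max_card _) _.
(* The bound n! <= n ^ n comes from viewing permutations as functions. *)
rewrite /ncells -card_ffun.
apply: (leq_card (fun s : {perm cell lam mu} => [ffun x => s x])).
by move=> s t /ffunP eq_st; apply/permP => x; have := eq_st x; rewrite !ffunE.
Qed.

Lemma sorted_standard lam mu (T : filling lam mu) :
  is_skew_shape lam mu -> injective T ->
  (forall c, 1 <= T c <= ncells lam mu) -> (forall c, ~~ misplaced T c) ->
  is_standard T.
Proof.
move=> shape T_inj T_bd T_sorted.
have lt_trans (x y z : cell lam mu) : T x < T y -> T y < T z -> T x < T z.
  exact: ltn_trans.
have lt_T x y : above x y || left_of x y -> T x < T y.
  move=> xy; have := T_sorted y; apply: contraNT => ge_T.
  by apply/existsP; exists x; rewrite xy.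
split=> //.
  by apply: same_row_rel => // x y xy; apply: lt_T; rewrite xy orbT.
by apply: same_column_rel => // x y xy; apply: lt_T; rewrite xy.
Qed.

Lemma jdt_shift lam mu (T : filling lam mu) a :
  is_skew_shape lam mu -> is_standard T ->
  is_standard (jdt (shift_filling a T)) /\
  exists2 s, preserves_components s &
    forall c, jdt (shift_filling a T) c = add_mod (ncells lam mu) a (T (s c)).
Proof.
move=> shape [T_inj T_bd _ _].
have n_gt0 (c : cell lam mu) : 0 < ncells lam mu by apply/card_gt0P; exists c.
have shift_inj : injective (shift_filling a T).
  by move=> x y; rewrite !ffunE => /add_mod_inj eq_T; apply: T_inj; apply: eq_T.
have [s sP jdtE] := jdt_permutes (shift_filling a T).
split; last by exists s => // c; rewrite jdtE !ffunE.
apply: sorted_standard (jdt_sorts shift_inj) => //; rewrite jdtE.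
  by move=> x y; rewrite !(ffunE (fun x => _ (s x))) => /shift_inj/perm_inj.
by move=> c; rewrite !ffunE; apply: add_mod_bounds (n_gt0 c).
Qed.

(** * Strips *)

Lemma strip_component_cases lam mu (c d : cell lam mu) : is_strip lam mu ->
  connect (@adjacent lam mu) c d -> crow c = crow d \/ ccol c = ccol d.
Proof.
case=> _ /(_ c) strip cd.
have c_c : c \in component c by rewrite inE connect0.
have d_c : d \in component c by rewrite inE.
case/orP: strip => /forall_inP/(_ c c_c)/forall_inP/(_ d d_c)/eqP; auto.
Qed.

(** A component of a strip lies in one row or one column, so row + column is a
    coordinate along it. *)
Lemma component_key_inj lam mu (c d : cell lam mu) : is_strip lam mu ->
  connect (@adjacent lam mu) c d -> crow c + ccol c = crow d + ccol d -> c = d.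
Proof.
move=> strip cd key; case: (strip_component_cases strip cd) => eq_cd.
  by apply: cell_eq => //; lia.
by apply: cell_eq => //; lia.
Qed.

Lemma standard_component_mono lam mu (T : filling lam mu) c d :
  is_strip lam mu -> is_standard T -> connect (@adjacent lam mu) c d ->
  (T c < T d) = (crow c + ccol c < crow d + ccol d).
Proof.
move=> strip [T_inj _ T_row T_col] cd.
have mono x y : connect (@adjacent lam mu) x y ->
    crow x + ccol x < crow y + ccol y -> T x < T y.
  by move=> xy key; case: (strip_component_cases strip xy) => eq_xy;
     [apply: T_row | apply: T_col] => //; lia.
case: (ltngtP (crow c + ccol c) (crow d + ccol d)) => key.
- exact: mono.
- by apply/negbTE; rewrite -leqNgt ltnW // mono // adjacent_connect_sym.
- by rewrite (component_key_inj strip cd key) ltnn.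
Qed.

(** Standard fillings increase along each component, so s is an increasing
    permutation of each component, hence the identity. *)
Lemma standard_component_unique lam mu (T U : filling lam mu) s :
  is_strip lam mu -> is_standard T -> is_standard U ->
  preserves_components s -> (forall c, U c = T (s c)) -> U = T.
Proof.
move=> strip Tstd Ustd sP UE.
suff s1 c : s c = c by apply/ffunP => c; rewrite UE s1.
apply/eqP; apply: contraT => c_moved.
(* If x has the least key among the moved cells, then s sends x up, and sends
   some larger z down to x, which contradicts monotonicity. *)
pose key (x : cell lam mu) := crow x + ccol x.
case: (arg_minnP (P := fun x => s x != x) key c_moved) => x x_moved x_min.
have lt_key y : s y != y -> y != x -> connect (@adjacent lam mu) x y ->
    key x < key y.
  move=> y_moved ne_yx xy; rewrite ltn_neqAle x_min // andbT.
  by apply: contraNneq ne_yx => /(component_key_inj strip xy) ->.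
have lt_sx : key x < key (s x).
  by apply: lt_key => //; apply: contraNneq x_moved => /perm_inj ->.
pose z := (s^-1)%g x; have sz : s z = x by rewrite permKV.
have xz : connect (@adjacent lam mu) x z.
  by rewrite adjacent_connect_sym -[X in connect _ _ X]sz.
have ne_zx : z != x by apply: contraNneq x_moved => zx; rewrite -{1}zx sz.
have lt_z : key x < key z by apply: lt_key => //; rewrite sz eq_sym.
have := standard_component_mono strip Ustd xz.
rewrite lt_z !UE sz (standard_component_mono strip Tstd); last first.
  by rewrite adjacent_connect_sym.
by rewrite -/(key _) -/(key x); lia.
Qed.

(** * Cyclic descents and components *)

(** Moving c to an adjacent cell changes its row by at most one, and never to
    the row of d, because all cells of that row belong to the component of d. *)
Lemma crow_lt_connectl lam mu (c c' d : cell lam mu) :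
  is_skew_shape lam mu -> connect (@adjacent lam mu) c c' ->
  ~~ connect (@adjacent lam mu) c d -> (crow c < crow d) = (crow c' < crow d).
Proof.
move=> shape /connectP[p]; elim: p c => [c _ -> //|e p IHp c /= /andP[ce e_p]].
move=> c'E not_cd.
have not_ed : ~~ connect (@adjacent lam mu) e d.
  by apply: contra not_cd; apply: connect_trans (connect1 ce).
rewrite -(IHp e) //.
have ne_row x : ~~ connect (@adjacent lam mu) x d -> crow x <> crow d.
  by move=> /negP not_xd /(same_row_connect shape).
have := ne_row c not_cd; have := ne_row e not_ed; move: ce.
by rewrite /adjacent /above /left_of; lia.
Qed.

Lemma crow_lt_connect lam mu (c c' d d' : cell lam mu) :
  is_skew_shape lam mu -> connect (@adjacent lam mu) c c' ->
  connect (@adjacent lam mu) d d' -> ~~ connect (@adjacent lam mu) c d ->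
  (crow c < crow d) = (crow c' < crow d').
Proof.
move=> shape cc' dd' not_cd; rewrite (crow_lt_connectl shape cc') //.
have conn_sym := @adjacent_connect_sym lam mu.
have not_dc' : ~~ connect (@adjacent lam mu) d c'.
  by rewrite conn_sym -(same_connect conn_sym cc').
have not_d'c' : ~~ connect (@adjacent lam mu) d' c'.
  by rewrite -(same_connect conn_sym dd').
have ne_row x : ~~ connect (@adjacent lam mu) x c' -> crow x <> crow c'.
  by move=> /negP not_xc /(same_row_connect shape).
have := crow_lt_connectl shape dd' not_dc'.
by have := ne_row _ not_dc'; have := ne_row _ not_d'c'; lia.
Qed.

(** For the cells c of i and d of i + 1 modulo n, one condition that covers both
    the ordinary descents and the wrap-around from n to 1. *)
Definition cyclic_descent_cells lam mu (c d : cell lam mu) : bool :=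
  if connect (@adjacent lam mu) c d then is_vertical (component c)
  else crow c < crow d.

Lemma cyclic_descent_cells_connect lam mu (c c' d d' : cell lam mu) :
  is_skew_shape lam mu -> connect (@adjacent lam mu) c c' ->
  connect (@adjacent lam mu) d d' ->
  cyclic_descent_cells c d = cyclic_descent_cells c' d'.
Proof.
move=> shape cc' dd'; have conn_sym := @adjacent_connect_sym lam mu.
rewrite /cyclic_descent_cells.
have -> : component c' = component c.
  by apply/setP => x; rewrite !inE (same_connect conn_sym cc').
rewrite -(same_connect conn_sym cc') -(same_connect_r conn_sym dd').
by case: ifPn => // /(crow_lt_connect shape cc' dd').
Qed.

Lemma vertical_of_lower lam mu (c d : cell lam mu) : is_strip lam mu ->
  connect (@adjacent lam mu) c d -> crow c < crow d ->
  is_vertical (component c).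
Proof.
move=> [_ /(_ c) strip] cd lt_cd.
have c_c : c \in component c by rewrite inE connect0.
have d_c : d \in component c by rewrite inE.
rewrite /is_vertical; case/orP: strip => [|->] /=.
  move=> /forall_inP/(_ c c_c)/forall_inP/(_ d d_c)/eqP eq_cd.
  by rewrite eq_cd ltnn in lt_cd.
apply/card_gt1P; exists c, d; split=> //.
by apply: contraTneq lt_cd => ->; rewrite ltnn.
Qed.

Lemma vertical_lower lam mu (T : filling lam mu) (c d : cell lam mu) :
  is_standard T -> connect (@adjacent lam mu) c d ->
  is_vertical (component c) -> T c < T d -> crow c < crow d.
Proof.
move=> [_ _ _ T_col] cd /andP[col _] lt_T.
have c_c : c \in component c by rewrite inE connect0.
have d_c : d \in component c by rewrite inE.
move: col => /forall_inP/(_ c c_c)/forall_inP/(_ d d_c)/eqP eq_col.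
case: (ltngtP (crow c) (crow d)) => // [lt_dc|eq_row].
  by have := T_col d c (esym eq_col) lt_dc; lia.
by rewrite (cell_eq eq_row eq_col) ltnn in lt_T.
Qed.

(** For i < n with i and i + 1 in one component, i + 1 is lower than i exactly
    when that component is vertical; for i = n the vertical case is the extra
    clause of the definition. *)
Lemma cDesP lam mu (T : filling lam mu) i : is_strip lam mu -> is_standard T ->
  reflect (exists c d, [/\ T c = i, T d = add_mod (ncells lam mu) 1%R i
                         & cyclic_descent_cells c d])
          (i \in cDes T).
Proof.
move=> strip Tstd; have [_ T_bd _ _] := Tstd.
rewrite mem_filter mem_iota; apply: (iffP andP).
  move=> [desc i_bd]; move: desc; rewrite add_mod1; last by lia.
  case: eqP => [->|ne_in].
    move=> /existsP[c /existsP[d /and3P[/eqP Tc /eqP Td desc]]].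
    exists c, d; split=> //; rewrite /cyclic_descent_cells.
    move: desc; rewrite inE; case: ifP => cd /=; last by rewrite orbF.
    by case/orP => //; apply: vertical_of_lower.
  rewrite mem_filter => /andP[].
  move=> /existsP[c /existsP[d /and3P[/eqP Tc /eqP Td lt_cd]]] _.
  exists c, d; split=> //; rewrite /cyclic_descent_cells.
  by case: ifP => // cd; apply: vertical_of_lower lt_cd.
move=> [c [d [Tc Td desc]]]; have i_bd := T_bd c; rewrite Tc in i_bd.
split; last by lia.
move: Td; rewrite add_mod1 //; case: eqP => [in_n|ne_in] Td.
  apply/existsP; exists c; apply/existsP; exists d.
  rewrite Tc Td in_n !eqxx inE /=; move: desc; rewrite /cyclic_descent_cells.
  by case: ifP => /= _ ->; rewrite ?orbT.
rewrite mem_filter mem_iota; apply/andP; split; last by lia.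
apply/existsP; exists c; apply/existsP; exists d.
rewrite Tc Td !eqxx /=; move: desc; rewrite /cyclic_descent_cells.
by case: ifP => // cd vert; apply: vertical_lower Tstd cd vert _; rewrite Tc Td.
Qed.

Theorem corollary4p2 (lam mu : seq nat) (hshape : is_strip lam mu)
    (T : filling lam mu) (hT : is_standard T) :
  [/\ is_standard (phi T), is_standard (promotion T),
      promotion (phi T) = T, phi (promotion T) = T
    & cDes (phi T) =i shift_set (ncells lam mu) 1%Z (cDes T)].
Proof.
have [shape _] := hshape; have [_ T_bd _ _] := hT.
have jdt_shiftK a b : (a + b = 0)%R ->
    jdt (shift_filling b (jdt (shift_filling a T))) = T.
  move=> ab0; have [aT_std [s sP aTE]] := jdt_shift a shape hT.
  have [bT_std [t tP bTE]] := jdt_shift b shape aT_std.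
  apply: (standard_component_unique hshape hT bT_std
            (preserves_componentsM tP sP)) => c.
  by rewrite bTE aTE permM add_modK.
have [phi_std [s sP phiE]] := jdt_shift 1%R shape hT.
have [prom_std _] := jdt_shift (-1)%R shape hT.
split=> //; [exact: jdt_shiftK | exact: jdt_shiftK |].
have n_gt0 (c : cell lam mu) : 0 < ncells lam mu by have := T_bd c; lia.
move=> i; apply/(cDesP _ hshape phi_std)/mapP.
  move=> [c [d [phi_c phi_d desc]]].
  exists (T (s c)); last by rewrite -phi_c -phiE.
  apply/(cDesP _ hshape hT); exists (s c), (s d); split=> //.
    apply: (@add_mod_inj (ncells lam mu) 1%R) => //.
      exact/add_mod_bounds/n_gt0.
    by rewrite -!phiE phi_d phi_c.
  by rewrite -(cyclic_descent_cells_connect shape (sP c) (sP d)).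
move=> [j /(cDesP _ hshape hT)[c [d [Tc Td desc]]] ->].
exists ((s^-1)%g c), ((s^-1)%g d); split.
- by rewrite /phi phiE permKV Tc.
- by rewrite /phi phiE permKV Td.
rewrite (cyclic_descent_cells_connect shape (sP _) (sP _)).
by rewrite !permKV.
Qed.
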